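(* Let $R$ be a commutative ring. If $D(R) < \infty$, then $|R| < \infty$.
   Context: Rings are commutative and unital (not assumed finite). For a commutative semigroup $S$ with identity, written multiplicatively, a finite sequence $A$ of elements of $S$ has product $\pi(A)$, the empty sequence having product $1$. The sequence $A$ is reducible if there is a proper subsequence $A' \subsetneq A$ (possibly empty) with $\pi(A') = \pi(A)$; otherwise it is irreducible. The Davenport constant $D(S)$ is the minimum positive integer $k$ such that every sequence of $k$ elements of $S$ is reducible, with $D(S) = \infty$ if no such $k$ exists. For a ring $R$, $D(R)$ denotes $D$ of the semigroup of all elements of $R$ under multiplication. *)

(* Defs.v *)
From HB Require Import structures.
From mathcomp Require Import all_boot all_order all_algebra.
From mathcomp Require Import boolp classical_sets functions cardinality.

Set Implicit Arguments.
Unset Strict Implicit.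
Unset Printing Implicit Defensive.

Import GRing.Theory.

Section Davenport.

(* The carrier of a commutative semigroup S with identity [one]. *)
Variables (S : eqType) (one : S) (mul : Monoid.com_law one).

Definition seq_prod (A : seq S) : S := \big[mul/one]_(x <- A) x.

(* A subsequence of A different from A as a list is necessarily shorter, so
   this is the removal of a nonempty set of positions; values may repeat. *)
Definition reducible (A : seq S) : Prop :=
  exists A' : seq S, [/\ subseq A' A, A' <> A & seq_prod A' = seq_prod A].

Definition davenport_bound (k : nat) : Prop :=
  0 < k /\ forall A : seq S, size A = k -> reducible A.

Lemma davenport_bound_ex :
  (exists k, davenport_bound k) -> exists k, `[< davenport_bound k >].
Proof. by case=> k kP; exists k; apply/asboolP. Qed.

(* [None] stands for the value infinity. *)
Definition davenport : option nat :=
  match pselect (exists k, davenport_bound k) with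
  | left kP => Some (ex_minn (davenport_bound_ex kP))
  | right _ => None
  end.

Lemma davenport_SomeP (k : nat) :
  davenport = Some k <->
  davenport_bound k /\ forall j, davenport_bound j -> k <= j.
Proof.
rewrite /davenport; case: pselect => [kP|nkP]; last first.
  by split=> // -[kP _]; case: nkP; exists k.
case: ex_minnP => m /asboolP mP m_min; split=> [[<-]|[kP' k_min]].
  by split=> // j jP; apply/m_min/asboolP.
by congr Some; apply/eqP; rewrite eqn_leq k_min // m_min //; apply/asboolP.
Qed.

Lemma davenport_NoneP :
  davenport = None <-> ~ exists k, davenport_bound k.
Proof. by rewrite /davenport; case: pselect. Qed.

End Davenport.

Arguments davenport {S one} mul.

Definition ring_davenport (R : comPzRingType) : option nat :=
  davenport (S := R) ( *%R : Monoid.com_law 1%R).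

(* Main.v *)
Require Import Defs.
From HB Require Import structures.
From mathcomp Require Import all_boot all_order all_algebra.
From mathcomp Require Import boolp classical_sets functions cardinality.
From mathcomp Require Import ring.

(** Let k bound the Davenport constant.  The proof writes every element of R as
    a unit minus an idempotent and shows that both kinds are finite in number,
    since an infinite supply of either yields an irreducible sequence of length
    k.

    - Units ([unit_irreducible]): a greedy choice works.  If A is an irreducible
      sequence of units, x may be prepended unless x pi(A) is one of the
      finitely many subproducts of A, which excludes finitely many units x.
    - Idempotents ([idem_irreducible]): those below an idempotent g correspond
      to pairs of idempotents below h and below g - h, for any idempotent
      h <= g.  If they are infinitely many, one of the two parts of a nontrivial
      splitting is again infinite, and iterating gives a strictly decreasing
      chain 1 > h_1 > h_2 > ... .  The differences d_i = h_(i-1) - h_i are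
      nonzero and orthogonal, so omitting a factor 1 - d_i from their product
      changes the product on the component d_i: the sequence of the 1 - d_i is
      irreducible.
    - Decomposition ([unit_sub_idem]): reducibility of the sequence x, ..., x
      gives x^j = x^k with j < k, so some power e = x^N with N > 0 is
      idempotent.  On the component eR, x is invertible; on the component
      (1 - e)R, x is nilpotent and x + 1 is invertible.  Hence x + (1 - e) is a
      unit of R. *)

Set Implicit Arguments.
Unset Strict Implicit.
Unset Printing Implicit Defensive.

Import GRing.Theory.
Local Open Scope ring_scope.
Local Open Scope classical_set_scope.

Section DavenportRing.

Variable R : comPzRingType.
Implicit Types (x y g h e : R) (A B : seq R).

Local Notation pi := (seq_prod ( *%R : Monoid.com_law (1 : R))).
Local Notation reducible := (reducible ( *%R : Monoid.com_law (1 : R))).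
Local Notation bound := (davenport_bound ( *%R : Monoid.com_law (1 : R))).

Lemma seq_prod_cons x A : pi (x :: A) = x * pi A.
Proof. by rewrite /seq_prod big_cons. Qed.

(** * Irreducible sequences *)

(** Irreducibility of A as seen after multiplication by g.  The factor g carries
    the product of the terms already chosen (for units) or the component of R
    still to be split (for idempotents). *)
Definition irreducible_at g A : Prop :=
  forall B, subseq B A -> g * pi B = g * pi A -> B = A.

Lemma irreducible_at1 A : irreducible_at 1 A -> ~ reducible A.
Proof. by move=> irrA [B [sBA neBA eq_pi]]; apply/neBA/irrA; rewrite // eq_pi. Qed.

(** A subsequence of x :: A either keeps x, and the hypothesis on A applies, or
    is a subsequence of A. *)
Lemma irreducible_at_cons g x A :
  irreducible_at (g * x) A ->
  (forall B, subseq B A -> g * pi B <> g * x * pi A) ->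
  irreducible_at g (x :: A).
Proof.
move=> irrA nox [|y B].
  by move=> _; rewrite seq_prod_cons mulrA => /nox; case; exact: sub0seq.
rewrite [subseq _ _]/=; case: eqP => [->|_] sBA.
  by rewrite !seq_prod_cons !mulrA => /(irrA _ sBA) ->.
by rewrite [pi (x :: A)]seq_prod_cons [RHS]mulrA => /nox; case.
Qed.

(** * Units *)

Definition units : set R := [set x | exists y, x * y = 1].

Lemma infinite_notin (T : eqType) (X : set T) (s : seq T) :
  infinite_set X -> exists2 x, X x & x \notin s.
Proof.
move=> infX; apply: contrapT => nox; apply: infX.
apply: (sub_finite_set _ (finite_seq s)) => x Xx /=.
by apply: contrapT => /negP xs; apply: nox; exists x.
Qed.

Lemma unit_irreducible n : infinite_set units ->
  exists A, [/\ size A = n, units (pi A) & irreducible_at 1 A].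
Proof.
move=> infU; elim: n => [|n [A [sA [v piAv] irrA]]].
  exists [::]; split=> //; first by exists 1; rewrite /seq_prod big_nil mul1r.
  by move=> B; rewrite subseq0 => /eqP.
(* v is the inverse of pi(A), so the forbidden x are the pi(B) v. *)
pose forbidden := [seq pi (mask m A) * v | m : (size A).-tuple bool].
have [x [y xy] xF] := infinite_notin forbidden infU.
exists (x :: A); split; first by rewrite /= sA.
  by exists (y * v); rewrite seq_prod_cons mulrACA xy piAv mul1r.
apply: irreducible_at_cons => [B sBA|B /subseqP[m sm ->]].
  rewrite mul1r => /(congr1 ( *%R y)); rewrite !mulrA [y * x]mulrC xy.
  exact: irrA.
rewrite !mul1r => eq_pi; move/negP: xF; apply; apply/mapP.
exists (Tuple (introT eqP sm)); first by rewrite mem_enum.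
by rewrite /= eq_pi -mulrA piAv mulr1.
Qed.

(** * Idempotents *)

(** The idempotents below g for the order e <= g iff g e = e. *)
Definition idem_below g : set R := [set e | e * e = e /\ g * e = e].

Lemma idem_belowM e a : e * e = e -> a * a = a -> idem_below a (e * a).
Proof. by move=> ee aa; split; [rewrite mulrACA ee aa | rewrite mulrCA aa]. Qed.

(** For a <= g, the map e |-> (e a, e (g - a)) embeds the idempotents below g
    into pairs of idempotents below a and g - a, so one of these two sets is
    infinite; h is that part of a splitting with a different from 0 and g. *)
Lemma infinite_idem_split g : g * g = g -> infinite_set (idem_below g) ->
  exists h, [/\ h * h = h, g * h = h, h <> g & infinite_set (idem_below h)].
Proof.
move=> gg infg.
have [a [aa ga]] := infinite_notin [:: 0; g] infg.
rewrite !inE => /norP[/eqP a_neq0 /eqP a_neqg].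
have [fina|infa] := pselect (finite_set (idem_below a)); last by exists a.
have bb : (g - a) * (g - a) = g - a.
  by rewrite mulrBl !mulrBr gg [a * g]mulrC ga aa subrr subr0.
exists (g - a); split=> //.
- by rewrite mulrBr gg ga.
- by move=> /eqP; rewrite subr_eq -{1}[g]addr0 => /eqP /addrI /esym.
move=> finga; apply: infg.
apply: sub_finite_set (finite_image2 (fun x y : R => x + y) fina finga).
move=> e [ee ge]; exists (e * a); first exact: idem_belowM.
exists (e * (g - a)); first exact: idem_belowM.
by rewrite -mulrDr addrC subrK mulrC.
Qed.

(** A starts with 1 - (g - h) and continues with the sequence obtained for h.
    On the component (g - h)R the first term vanishes, while the others act as
    1 because they do so on (1 - h)R; hence no product of the others alone can
    equal the full product.  The second condition on A carries this through the
    induction. *)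
Lemma idem_irreducible n g : g * g = g -> infinite_set (idem_below g) ->
  exists A, [/\ size A = n, {in A, forall c, c * (1 - g) = 1 - g}
              & irreducible_at g A].
Proof.
elim: n g => [|n IHn] g gg infg.
  by exists [::]; split=> // B; rewrite subseq0 => /eqP.
have [h [hh gh h_neqg infh]] := infinite_idem_split gg infg.
have [A [sA fixA irrA]] := IHn h hh infh.
have gb : g * (1 - (g - h)) = h by rewrite mulrBr mulrBr gg gh mulr1 subKr.
have hg1 : (1 - h) * (1 - g) = 1 - g.
  by rewrite mulrBl mul1r mulrBr mulr1 [h * g]mulrC gh subrr subr0.
exists (1 - (g - h) :: A); split; first by rewrite /= sA.
  move=> c; rewrite inE => /predU1P[->|cA].
    by rewrite [LHS]mulrBr mulr1 [X in _ - X]mulrC gb; ring.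
  by rewrite -hg1 mulrA fixA.
apply: irreducible_at_cons; rewrite gb // => B sBA eq_pi; apply: h_neqg.
have piB : pi B * (1 - h) = 1 - h.
  have: {subset B <= A} by exact: mem_subseq.
  elim: B {sBA eq_pi} => [|c B IHB] sBA; first by rewrite /seq_prod big_nil mul1r.
  rewrite seq_prod_cons -mulrA IHB ?fixA ?sBA ?mem_head // => x xB.
  by apply: sBA; rewrite inE xB orbT.
move/(congr1 ( *%R^~ (1 - h))): eq_pi; rewrite -mulrA piB mulrAC.
by rewrite !mulrBr !mulr1 hh gh subrr mul0r => /eqP; rewrite subr_eq0 => /eqP.
Qed.

(** * Decomposition of elements *)

Section Bounded.

Variables (k : nat) (boundk : bound k).

Lemma finite_units : finite_set units.
Proof.
apply: contrapT => /(unit_irreducible k)[A [sA _ /irreducible_at1]]; apply.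
exact: (boundk.2 A sA).
Qed.

Lemma finite_idem : finite_set (idem_below 1).
Proof.
apply: contrapT => /(idem_irreducible k (mul1r 1))[A [sA _ /irreducible_at1]].
by apply; exact: (boundk.2 A sA).
Qed.

Lemma expr_loop x : exists2 j, (j < k)%N & x ^+ j = x ^+ k.
Proof.
have pi_nseq n : pi (nseq n x) = x ^+ n.
  elim: n => [|n IHn]; first by rewrite /seq_prod big_nil.
  by rewrite [nseq _ _]/= seq_prod_cons IHn exprS.
have [B [sBk neBk eq_pi]] := boundk.2 _ (size_nseq k x).
have eqB : B = nseq (size B) x.
  apply/all_pred1P/allP => y /(mem_subseq sBk).
  by rewrite mem_nseq => /andP[].
exists (size B); last by rewrite -!pi_nseq -eqB.
have := size_subseq sBk; rewrite size_nseq leq_eqVlt => /predU1P[sB|//].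
by case: neBk; rewrite eqB sB.
Qed.

(** The powers of x are periodic with period k - j from x^j on, so any multiple
    N >= j of the period gives x^N = x^(2N). *)
Lemma expr_idem x : exists N, x ^+ N.+1 * x ^+ N.+1 = x ^+ N.+1.
Proof.
have [j ltjk eqx] := expr_loop x.
have k_gt0 : (0 < k)%N by case: boundk.
have period i m : (j <= m)%N -> x ^+ (m + i * (k - j)) = x ^+ m.
  move=> lejm; elim: i => [|i IHi]; first by rewrite mul0n addn0.
  rewrite mulSnr addnA exprD IHi -(subnK lejm) exprD -mulrA -exprD.
  by rewrite (subnKC (ltnW ltjk)) eqx.
have lejN : (j <= k * (k - j))%N.
  by rewrite (leq_trans (ltnW ltjk)) // leq_pmulr // subn_gt0.
exists (k * (k - j)).-1; rewrite prednK; first by rewrite -exprD period.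
by rewrite muln_gt0 k_gt0 subn_gt0.
Qed.

Lemma unit_sub_idem x : exists2 f, idem_below 1 f & units (x + f).
Proof.
have [N ee] := expr_idem x.
set e := x ^+ N.+1 in ee.
have ff : (1 - e) * (1 - e) = 1 - e.
  by rewrite mulrBl mul1r mulrBr mulr1 ee subrr subr0.
have ef : e * (1 - e) = 0 by rewrite mulrBr mulr1 ee subrr.
exists (1 - e); first by split; rewrite ?mul1r.
(* The inverse of x on eR is x^N e.  On (1 - e)R, where (- x)^(N + 1) = 0, the
   inverse of x + 1 is the truncated geometric series of - x. *)
pose s := \sum_(i < N.+1) (- x) ^+ i.
have s_inv : (x + 1) * s * (1 - e) = 1 - e.
  have := subrX1 (- x) N.+1; rewrite -/s exprNn -/e => eq_s.
  have -> : (x + 1) * s = 1 - (-1) ^+ N.+1 * e.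
    by rewrite -[RHS]opprB eq_s -mulNr opprB opprK addrC.
  by rewrite mulrBl mul1r -mulrA ef mulr0 subr0.
exists (x ^+ N * e + s * (1 - e)).
have -> : (x + (1 - e)) * (x ^+ N * e + s * (1 - e))
  = x * x ^+ N * e + (x + 1) * s * (1 - e)
    + (x ^+ N * (e * (1 - e)) + s * ((1 - e) * (1 - e) - (1 - e))) by ring.
by rewrite -exprS -/e s_inv ee ef ff subrr !mulr0 !addr0 addrC subrK.
Qed.

Lemma finite_of_davenport_bound : finite_set [set: R].
Proof.
apply: sub_finite_set
  (finite_image2 (fun u f : R => u - f) finite_units finite_idem).
move=> x _; have [f fP uP] := unit_sub_idem x.
by exists (x + f) => //; exists f => //; rewrite addrK.
Qed.

End Bounded.

End DavenportRing.

Theorem theorem3p1 (R : comPzRingType) :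
  ring_davenport R <> None -> finite_set [set: R]%classic.
Proof.
move=> finD; apply: contrapT => infR; apply: finD; apply/davenport_NoneP.
by case=> k /finite_of_davenport_bound.
Qed.
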